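(* Let $d\ge 2$, let $K$ be a field of characteristic not dividing $d$, and let $f(z)=z^d+c\in K[z]$ with $c\neq 0$. If there is a discrete non-archimedean absolute value $|\cdot|$ on $K$ with $|c|<1$, then $f$ is eventually stable over $K$.
   Context: $f^n$ denotes the $n$th iterate of $f$. A polynomial $f\in K[z]$ is eventually stable over $K$ if there is an $N\ge 0$ and a fixed $t$, depending only on $f$, such that for all $n>N$, $f^n$ is a product of exactly $t$ irreducible factors in $K[z]$. *)

(* Defs.v *)
From HB Require Import structures.
From mathcomp Require Import all_boot all_order all_algebra.
From mathcomp Require Import all_classical all_reals all_analysis.

Set Implicit Arguments.
Unset Strict Implicit.
Unset Printing Implicit Defensive.

Import Order.TTheory GRing.Theory Num.Theory.
Import numFieldNormedType.Exports.

Local Open Scope classical_set_scope.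
Local Open Scope ring_scope.

(* The ultrametric inequality together with nonnegativity implies the triangle
   inequality, so the latter is not a separate field. *)
Record nonarchimedean_absolute_value (K : fieldType) (R : realType)
    (v : K -> R) : Prop := {
  nav_ge0 : forall x, 0 <= v x;
  nav_eq0 : forall x, v x = 0 <-> x = 0;
  navM : forall x y, v (x * y) = v x * v y;
  nav_ultra : forall x y, v (x + y) <= Num.max (v x) (v y) }.

Definition value_group (K : fieldType) (R : realType) (v : K -> R) : set R :=
  [set v x | x in [set x : K | x != 0]].

(* Every point of the value group is isolated in it. As the group lies in the
   open subset ]0, +oo[ of R, this is discreteness as a subgroup of the positive
   reals; 0 is allowed to be a limit point. *)
Definition discrete_value_group (K : fieldType) (R : realType) (v : K -> R)
    : Prop :=
  value_group v `<=` isolated (value_group v).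

Definition poly_iter (K : fieldType) (f : {poly K}) (n : nat) : {poly K} :=
  iter n (fun g => f \Po g) 'X.

Lemma horner_poly_iter (K : fieldType) (f : {poly K}) (n : nat) (x : K) :
  (poly_iter f n).[x] = iter n (fun y => f.[y]) x.
Proof.
by elim: n => [|n IHn] /=; rewrite ?hornerX // horner_comp IHn.
Qed.

(* Factors are counted with multiplicity and need not be monic, so for t > 0
   no separate unit factor is needed. *)
Definition product_of_irreducibles (K : fieldType) (t : nat) (p : {poly K})
    : Prop :=
  exists s : seq {poly K},
    [/\ size s = t, (forall q, q \in s -> irreducible_poly q)
      & p = \prod_(q <- s) q].

Definition eventually_stable (K : fieldType) (f : {poly K}) : Prop :=
  exists N t : nat, forall n : nat, (N < n)%N ->
    product_of_irreducibles t (poly_iter f n).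

(* Main.v *)
Require Import Defs.
From HB Require Import structures.
From mathcomp Require Import all_boot all_order all_algebra.
From mathcomp Require Import all_classical all_reals all_analysis.

Set Implicit Arguments.
Unset Strict Implicit.
Unset Printing Implicit Defensive.

Import Order.TTheory GRing.Theory Num.Theory.
Import numFieldNormedType.Exports.

Local Open Scope ring_scope.

(** The proof is a quantitative form of Eisenstein's criterion.  As [|c| < 1],
    every iterate [f^n] reduces to the monomial [X^(d^n)] modulo the maximal
    ideal of the valuation ring, so every nonconstant factor of [f^n] also
    reduces, up to scaling, to a monomial: its constant coefficient is strictly
    smaller than its leading one.  To avoid normalising factors, this is phrased
    as domination of all coefficients by the leading one ([lead_dominant]), a
    property that passes both to products and to factors ([lead_dominantM]).

    By discreteness, an absolute value below 1 is at most some fixed [rho < 1],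
    so a product of [t] nonconstant factors that equals [f^n] gives
    [|f^n(0)| <= rho^t].  But the orbit of [0] under [f] stays on the
    sphere of radius [|c|]: since [d >= 2], [|f^n(0)| = |c| > 0] for all
    [n >= 1].  Hence [t] is bounded independently of [n].

    On the other hand, substituting [f] into a factorization of [f^n] gives one
    of [f^(n+1)] with as many nonconstant factors, so the largest possible
    number of factors is nondecreasing in [n].  Being bounded, it is eventually
    constant; and a factorization with the largest number of nonconstant factors
    consists of irreducible ones. *)

(** * Non-archimedean absolute values *)

Lemma nav1 (K : fieldType) (R : realType) (v : K -> R) :
  nonarchimedean_absolute_value v -> v 1 = 1.
Proof.
move=> hv; have v1_neq0 : v 1 != 0.
  by apply/eqP => /(nav_eq0 hv)/eqP; rewrite oner_eq0.
by apply: (mulfI v1_neq0); rewrite -(navM hv) !mulr1.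
Qed.

Lemma navX (K : fieldType) (R : realType) (v : K -> R) x n :
  nonarchimedean_absolute_value v -> v (x ^+ n) = v x ^+ n.
Proof.
move=> hv; elim: n => [|n IHn]; first by rewrite !expr0 nav1.
by rewrite !exprS (navM hv) IHn.
Qed.

Lemma nav0 (K : fieldType) (R : realType) (v : K -> R) :
  nonarchimedean_absolute_value v -> v 0 = 0.
Proof. by move=> hv; apply/(nav_eq0 hv). Qed.

Lemma nav_gt0 (K : fieldType) (R : realType) (v : K -> R) x :
  nonarchimedean_absolute_value v -> (0 < v x) = (x != 0).
Proof.
move=> hv; rewrite lt0r (nav_ge0 hv) andbT.
by congr (~~ _); apply/eqP/eqP => /(nav_eq0 hv).
Qed.

Lemma navN (K : fieldType) (R : realType) (v : K -> R) x :
  nonarchimedean_absolute_value v -> v (- x) = v x.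
Proof.
move=> hv; apply/eqP; rewrite -(@eqrXn2 _ 2) ?(nav_ge0 hv)//.
by rewrite -!navX// sqrrN.
Qed.

Lemma nav_addr_dominant (K : fieldType) (R : realType) (v : K -> R) x y :
  nonarchimedean_absolute_value v -> v x < v y -> v (x + y) = v y.
Proof.
move=> hv xy; apply/eqP; rewrite eq_le; apply/andP; split.
  by apply: le_trans (nav_ultra hv x y) _; rewrite ge_max (ltW xy) lexx.
have := nav_ultra hv (x + y) (- x); rewrite addrAC subrr add0r navN//.
by rewrite le_max [v y <= v x]leNgt xy orbF.
Qed.

Lemma nav_sum_lt (K : fieldType) (R : realType) (v : K -> R) (r : R)
    (I : Type) (s : seq I) (P : pred I) (F : I -> K) :
  nonarchimedean_absolute_value v -> 0 < r ->
  (forall i, P i -> v (F i) < r) -> v (\sum_(i <- s | P i) F i) < r.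
Proof.
move=> hv r0 hF; elim/big_ind: _ => //; first by rewrite nav0.
by move=> x y xr yr; apply: le_lt_trans (nav_ultra hv x y) _; rewrite gt_max xr.
Qed.

(** The gap comes from the isolation of [1 = v 1] in the value group. *)
Lemma discrete_value_gap (K : fieldType) (R : realType) (v : K -> R) :
  nonarchimedean_absolute_value v -> discrete_value_group v ->
  exists rho : R, [/\ 0 <= rho, rho < 1 & forall x, v x < 1 -> v x <= rho].
Proof.
move=> hv hdisc.
have : value_group v 1 by exists 1; [exact: oner_neq0 | exact: nav1].
move=> /hdisc[_ [V /nbhs_ballP[e /= e0 eV] VA]].
exists (Num.max 0 (1 - e)); split.
- by rewrite le_max lexx.
- by rewrite gt_max ltr01 ltrBlDr ltrDl.
move=> x x1; rewrite leNgt; apply/negP; rewrite gt_max => /andP[x0 xe].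
suff : [set (1 : R)]%classic (v x).
  by move=> /= x_eq1; move: x1; rewrite x_eq1 ltxx.
rewrite -VA; split; last by exists x => //=; rewrite -(nav_gt0 _ hv).
apply: eV; rewrite /ball /= gtr0_norm ?subr_gt0//.
by rewrite ltrBlDr addrC -ltrBlDr.
Qed.

(** * Polynomials dominated by their leading coefficient *)

(** For a monic polynomial with integral coefficients, this says that it reduces
    to a power of [X] over the residue field. *)
Definition lead_dominant (K : fieldType) (R : realType) (v : K -> R)
    (p : {poly K}) : Prop :=
  forall i, (i < (size p).-1)%N -> v p`_i < v (lead_coef p).

(** After scaling [p] to Gauss norm 1, the index [i] is the order of vanishing
    at 0 of its reduction over the residue field, which is why these indices add
    up in products. *)
Lemma first_max_coef (K : fieldType) (R : realType) (v : K -> R)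
    (p : {poly K}) : nonarchimedean_absolute_value v ->
  exists i, [/\ (i <= (size p).-1)%N, forall j, v p`_j <= v p`_i
    & forall j, (j < i)%N -> v p`_j < v p`_i].
Proof.
move=> hv; suff [i [ile imax ifirst]] : exists i, [/\ (i <= (size p).-1)%N,
    forall j, (j <= (size p).-1)%N -> v p`_j <= v p`_i
    & forall j, (j < i)%N -> v p`_j < v p`_i].
  exists i; split=> // j; have [/imax//|jgt] := leqP j (size p).-1.
  by rewrite nth_default ?nav0 ?(nav_ge0 hv)// (leq_trans (leqSpred _)).
elim: (size p).-1 => [|n [i [ile imax ifirst]]].
  by exists 0%N; split=> // j; rewrite leqn0 => /eqP->.
have [le_i|gt_i] := leP (v p`_n.+1) (v p`_i).
  exists i; split=> //; first exact: leqW.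
  by move=> j; rewrite leq_eqVlt ltnS => /predU1P[->|/imax].
exists n.+1; split=> // j; last by rewrite ltnS => /imax/le_lt_trans; apply.
by rewrite leq_eqVlt ltnS => /predU1P[->|/imax/le_trans]//; apply; apply: ltW.
Qed.

Lemma lead_dominant_le (K : fieldType) (R : realType) (v : K -> R)
    (p : {poly K}) i : nonarchimedean_absolute_value v ->
  lead_dominant v p -> v p`_i <= v (lead_coef p).
Proof.
move=> hv hp; case: (ltngtP i (size p).-1) => [/hp/ltW//|lti|->//].
by rewrite nth_default ?nav0 ?(nav_ge0 hv)// (leq_trans (leqSpred _)).
Qed.

(** The analogue of [X^n] having only powers of [X] as factors. In the direct
    implication, with [i] and [j] the least indices where [g] and [h] attain
    their Gauss norms, the coefficient of [g * h] at [i + j] attains the product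
    of the norms, so is at least the leading one; hence [i + j] is the degree of
    [g * h], and [i] and [j] those of [g] and [h]. *)
Lemma lead_dominantM (K : fieldType) (R : realType) (v : K -> R)
    (g h : {poly K}) : nonarchimedean_absolute_value v -> g != 0 -> h != 0 ->
  lead_dominant v (g * h) <-> lead_dominant v g /\ lead_dominant v h.
Proof.
move=> hv g0 h0.
have sgh : (size (g * h)).-1 = ((size g).-1 + (size h).-1)%N.
  rewrite size_mul//; move: g0 h0; rewrite -!size_poly_gt0.
  by case: (size g) (size h) => [|a] [|b]// _ _; rewrite addnS.
have lg0 : 0 < v (lead_coef g) by rewrite nav_gt0// lead_coef_eq0.
have lh0 : 0 < v (lead_coef h) by rewrite nav_gt0// lead_coef_eq0.
split=> [gh|[hg hh] n]; last first.
  rewrite sgh lead_coefM coefM (navM hv) => n_lt.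
  apply: nav_sum_lt => //; first exact: mulr_gt0.
  move=> [a /= a_le] _; rewrite (navM hv).
  have [a_lt|a_ge] := ltnP a (size g).-1.
    apply: le_lt_trans (_ : _ <= v g`_a * v (lead_coef h)) _.
      by rewrite ler_wpM2l ?(nav_ge0 hv)// lead_dominant_le.
    by rewrite ltr_pM2r//; exact: hg.
  apply: le_lt_trans (_ : _ <= v (lead_coef g) * v h`_(n - a)) _.
    by rewrite ler_wpM2r ?(nav_ge0 hv)// lead_dominant_le.
  rewrite ltr_pM2l//; apply: hh.
  by rewrite -(ltn_add2l a) subnKC// (leq_trans n_lt)// leq_add2r.
have [i [ile imax ifirst]] := first_max_coef g hv.
have [j [jle jmax jfirst]] := first_max_coef h hv.
have gi0 : 0 < v g`_i by apply: lt_le_trans lg0 (imax _).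
have hj0 : 0 < v h`_j by apply: lt_le_trans lh0 (jmax _).
have vij : v (g * h)`_(i + j) = v g`_i * v h`_j.
  (* every other term of the convolution involves [g`_a] with [a < i] or [h`_b]
     with [b < j], and is therefore strictly smaller *)
  have ij : (i < (i + j).+1)%N by rewrite ltnS leq_addr.
  rewrite coefM (bigD1 (Ordinal ij))//= addKn addrC -(navM hv).
  apply: nav_addr_dominant => //; apply: nav_sum_lt => //.
    by rewrite (navM hv) mulr_gt0.
  move=> [a /= a_le]; rewrite -val_eqE /= !(navM hv).
  case: ltngtP => // [a_lt|a_gt] _.
    apply: le_lt_trans (_ : _ <= v g`_a * v h`_j) _.
      by rewrite ler_wpM2l ?(nav_ge0 hv).
    by rewrite ltr_pM2r// ifirst.
  apply: le_lt_trans (_ : _ <= v g`_i * v h`_(i + j - a)) _.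
    by rewrite ler_wpM2r ?(nav_ge0 hv).
  by rewrite ltr_pM2l// jfirst// -(ltn_add2l a) subnKC// ltn_add2r.
have ijge : ((size g).-1 + (size h).-1 <= i + j)%N.
  rewrite leqNgt -sgh; apply/negP => /gh; rewrite vij lead_coefM (navM hv).
  by rewrite ltNge ler_pM ?(nav_ge0 hv) ?imax ?jmax.
have ei : i = (size g).-1.
  by apply/eqP; rewrite eqn_leq ile -(leq_add2r j) (leq_trans _ ijge)//
    leq_add2l.
have ej : j = (size h).-1.
  by apply/eqP; rewrite eqn_leq jle -(leq_add2l i) (leq_trans _ ijge)//
    leq_add2r.
by rewrite ei in ifirst; rewrite ej in jfirst.
Qed.

Lemma lead_dominantX (K : fieldType) (R : realType) (v : K -> R)
    (p : {poly K}) n : nonarchimedean_absolute_value v -> p != 0 ->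
  lead_dominant v p -> lead_dominant v (p ^+ n).
Proof.
move=> hv p0 hp; elim: n => [|n IHn].
  by move=> i; rewrite expr0 size_poly1.
by rewrite exprS; apply/lead_dominantM; rewrite ?expf_neq0.
Qed.

Lemma lead_dominant_addC (K : fieldType) (R : realType) (v : K -> R)
    (p : {poly K}) c : nonarchimedean_absolute_value v -> (1 < size p)%N ->
  v c < v (lead_coef p) -> lead_dominant v p -> lead_dominant v (p + c%:P).
Proof.
move=> hv p_gt1 c_lt hp i.
have szc : (size c%:P < size p)%N.
  by rewrite (leq_ltn_trans (size_polyC_leq1 c)).
rewrite size_polyDl// lead_coefDl// coefD coefC => i_lt.
apply: le_lt_trans (nav_ultra hv _ _) _; rewrite gt_max hp//=.
by case: eqP => // _; rewrite nav0// (le_lt_trans (nav_ge0 hv c)).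
Qed.

(** The ratio of the constant coefficient to the leading one is multiplicative,
    and has absolute value less than 1, hence at most [rho], on each factor. *)
Lemma lead_dominant_prod_coef0 (K : fieldType) (R : realType) (v : K -> R)
    (rho : R) (s : seq {poly K}) :
  nonarchimedean_absolute_value v -> 0 <= rho ->
  (forall x, v x < 1 -> v x <= rho) ->
  all (fun q : {poly K} => 1 < size q)%N s ->
  lead_dominant v (\prod_(q <- s) q) ->
  v (\prod_(q <- s) q)`_0 <= rho ^+ size s * v (lead_coef (\prod_(q <- s) q)).
Proof.
move=> hv rho0 gap; elim: s => [|q s IHs] /=.
  by rewrite big_nil expr0 mul1r lead_coef1 coef1.
move=> /andP[q_gt1 s_gt1]; rewrite big_cons.
have q0 : q != 0 by rewrite -size_poly_gt0 ltnW.
have s0 : \prod_(q <- s) q != 0.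
  rewrite prodf_seq_neq0; apply: sub_all s_gt1 => r /= r_gt1.
  by rewrite -size_poly_gt0 ltnW.
move=> /lead_dominantM-/(_ hv q0 s0)[hq /(IHs s_gt1) le_s].
rewrite coef0M lead_coefM !(navM hv) exprS mulrACA ler_pM ?(nav_ge0 hv)//.
have lq0 : lead_coef q != 0 by rewrite lead_coef_eq0.
have vlq0 : 0 < v (lead_coef q) by rewrite nav_gt0.
have ratioE : v q`_0 = v (q`_0 / lead_coef q) * v (lead_coef q).
  by rewrite -(navM hv) divfK.
rewrite ratioE ler_pM2r// gap// -(ltr_pM2r vlq0) mul1r -ratioE; apply: hq.
by rewrite -ltnS prednK// ltnW.
Qed.

(** * Factorizations into nonconstant polynomials *)

Definition has_nonconstant_factors (K : fieldType) (t : nat) (p : {poly K})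
    : Prop :=
  exists s : seq {poly K},
    [/\ size s = t, all (fun q : {poly K} => 1 < size q)%N s
    & p = \prod_(q <- s) q].

Lemma has_nonconstant_factors_comp (K : fieldType) t (p f : {poly K}) :
  (1 < size f)%N -> has_nonconstant_factors t p ->
  has_nonconstant_factors t (p \Po f).
Proof.
move=> f_gt1 [s [<- s_gt1 ->]]; exists [seq q \Po f | q <- s]; split.
- exact: size_map.
- rewrite all_map; apply: sub_all s_gt1 => q /= q_gt1.
  have : (0 < (size (q \Po f)).-1)%N.
    by rewrite size_comp_poly muln_gt0 -!subn1 !subn_gt0 q_gt1.
  by rewrite -subn1 subn_gt0.
- by rewrite rmorph_prod big_map.
Qed.

(** A reducible factor could be replaced by two nonconstant ones. *)
Lemma max_nonconstant_factors_irreducible (K : fieldType) t (p : {poly K}) :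
  has_nonconstant_factors t p -> ~ has_nonconstant_factors t.+1 p ->
  product_of_irreducibles t p.
Proof.
move=> [s [szs s_gt1 pE]] maxt; exists s; split=> // q qs.
have q_gt1 : (1 < size q)%N by apply: (allP s_gt1).
have q0 : q != 0 by rewrite -size_poly_gt0 ltnW.
split=> // a a_neq1 /dvdpP[b qE]; apply: contrapT => naq; apply: maxt.
move: (q0); rewrite qE mulf_eq0 negb_or => /andP[b0 a0].
have b_neq1 : size b != 1%N.
  apply/eqP => /eqP/size_poly1P[k k0 bE]; apply: naq.
  by rewrite qE bE mul_polyC eqp_sym eqp_scale.
exists [:: b, a & rem q s]; split=> /=.
- by rewrite size_rem// -szs prednK// -has_predT; apply/hasP; exists q.
- apply/and3P; split; last by apply/allP => r /mem_rem /(allP s_gt1).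
  + by rewrite ltn_neqAle eq_sym b_neq1 size_poly_gt0.
  + by rewrite ltn_neqAle eq_sym a_neq1 size_poly_gt0.
- by rewrite !big_cons mulrA -qE pE (perm_big _ (perm_to_rem qs)) big_cons.
Qed.

Lemma poly_iterSr (K : fieldType) (f : {poly K}) n :
  poly_iter f n.+1 = poly_iter f n \Po f.
Proof.
elim: n => [|n IHn]; first by rewrite /poly_iter /= comp_polyXr comp_polyX.
by rewrite -[LHS]/(f \Po poly_iter f n.+1) {1}IHn comp_polyA.
Qed.

Lemma eventually_stable_of_bounded_factors (K : fieldType) (f : {poly K}) B :
  (1 < size f)%N ->
  (forall n t, (0 < n)%N -> has_nonconstant_factors t (poly_iter f n) ->
    (t <= B)%N) ->
  eventually_stable f.
Proof.
move=> f_gt1 bound.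
pose P t := `[< exists2 n, (0 < n)%N &
  has_nonconstant_factors t (poly_iter f n) >].
have exP : exists t, P t.
  exists 1%N; apply/asboolP; exists 1%N => //; exists [:: f].
  by rewrite big_seq1 /poly_iter /= comp_polyXr f_gt1.
have leP t : P t -> (t <= B)%N by move=> /asboolP[n]; exact: bound.
have [t /asboolP[N N0 facN] tmax] := ex_maxnP exP leP.
exists N, t => n Nn; apply: max_nonconstant_factors_irreducible.
  rewrite -(subnKC (ltnW Nn)); elim: (n - N)%N => [|k IHk].
    by rewrite addn0.
  by rewrite addnS poly_iterSr; exact: has_nonconstant_factors_comp.
move=> facS; have /tmax : P t.+1.
  by apply/asboolP; exists n => //; exact: leq_trans Nn.
by rewrite ltnn.
Qed.

(** * Iterates of [X^d + c] *)

Lemma poly_iter_unicriticalS (K : fieldType) d (c : K) n :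
  poly_iter ('X^d + c%:P) n.+1 = poly_iter ('X^d + c%:P) n ^+ d + c%:P.
Proof. by rewrite /poly_iter /= comp_polyD comp_polyC comp_Xn_poly. Qed.

Lemma poly_iter_unicritical_dominant (K : fieldType) (R : realType) (v : K -> R)
    d (c : K) n : nonarchimedean_absolute_value v -> (0 < d)%N -> v c < 1 ->
  let p := poly_iter ('X^d + c%:P) n in
  [/\ (1 < size p)%N, lead_coef p = 1 & lead_dominant v p].
Proof.
move=> hv d0 c1 /=; elim: n => [|n [p_gt1 p1 hp]].
  rewrite /poly_iter /= size_polyX lead_coefX; split=> // i.
  rewrite size_polyX ltnS leqn0 => /eqP->.
  by rewrite coefX lead_coefX nav0 ?nav1.
rewrite poly_iter_unicriticalS.
set p := poly_iter _ n in p_gt1 p1 hp *.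
have pd_gt1 : (1 < size (p ^+ d))%N.
  have : (0 < (size (p ^+ d)).-1)%N.
    by rewrite size_exp muln_gt0 d0 -subn1 subn_gt0 p_gt1.
  by rewrite -subn1 subn_gt0.
have szc : (size c%:P < size (p ^+ d))%N.
  by rewrite (leq_ltn_trans (size_polyC_leq1 c)).
have pd1 : lead_coef (p ^+ d) = 1 by rewrite lead_coef_exp p1 expr1n.
rewrite size_polyDl// lead_coefDl//; split=> //.
apply: lead_dominant_addC => //; first by rewrite pd1 nav1.
by apply: lead_dominantX => //; rewrite -size_poly_gt0 ltnW.
Qed.

Lemma poly_iter_unicritical_coef0 (K : fieldType) (R : realType) (v : K -> R)
    d (c : K) n : nonarchimedean_absolute_value v -> (2 <= d)%N ->
  c != 0 -> v c < 1 -> v (poly_iter ('X^d + c%:P) n.+1)`_0 = v c.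
Proof.
move=> hv d2 c0 c1; elim: n => [|n IHn].
  rewrite poly_iter_unicriticalS /poly_iter /= coefD coefC coefXn /=.
  by rewrite (ltn_eqF (ltnW d2)) add0r.
rewrite poly_iter_unicriticalS coefD coefC /= -horner_coef0.
rewrite horner_exp horner_coef0.
apply: nav_addr_dominant => //; rewrite navX// IHn.
by rewrite -[ltRHS]expr1 ltr_iXn2l// nav_gt0.
Qed.

Theorem theorem5 (d : nat) (K : fieldType) (c : K) (hd : (2 <= d)%N)
    (hchar : forall p : nat, p \in [pchar K] -> ~~ (p %| d)%N)
    (hc : c != 0)
    (hv : exists (R : realType) (v : K -> R),
        [/\ nonarchimedean_absolute_value v, discrete_value_group v
          & v c < 1]) :
  eventually_stable ('X^d + c%:P).
Proof.
have [R [v [nav disc c1]]] := hv.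
have [rho [rho0 rho1 gap]] := discrete_value_gap nav disc.
have vc0 : 0 < v c by rewrite nav_gt0.
have [B rhoB] : exists B, rho ^+ B < v c.
  have /cvgr_lt/(_ _ vc0)[B _ rhoB] :
      ((fun n => rho ^+ n) @ \oo --> (0 : R))%classic.
    by apply: cvg_expr; rewrite ger0_norm.
  by exists B; apply: rhoB => /=.
apply: (@eventually_stable_of_bounded_factors _ _ B).
  by rewrite size_XnaddC// ltnW.
move=> [//|n] t _ [s [<- s_gt1 fE]].
have [_ lead1 dom] := poly_iter_unicritical_dominant n.+1 nav (ltnW hd) c1.
have := lead_dominant_prod_coef0 nav rho0 gap s_gt1.
rewrite -fE => /(_ dom); rewrite lead1 nav1// mulr1.
rewrite poly_iter_unicritical_coef0//.
rewrite leqNgt => le_c; apply/negP => /ltnW lt_s.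
have := le_lt_trans le_c (le_lt_trans (ler_wiXn2l rho0 (ltW rho1) lt_s) rhoB).
by rewrite ltxx.
Qed.
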